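(* Let $(\Omega,\mathcal{F})$ be a measurable space with a filtration $(\mathcal{F}_t)_{t\in[0,\infty)}$. The following three sets of mappings $X:\Omega\times[0,\infty)\to\mathbb{R}$ are equal: (1) the set of all adapted and absolutely continuous processes; (2) the set of all time integrals $X(\omega,t)=\int_0^t a(\omega,s)\,ds$, $(\omega,t)\in\Omega\times[0,\infty)$, where $a$ is a predictable and pathwise locally integrable process; (3) the set of all time integrals $X(\omega,t)=\int_0^t a(\omega,s)\,ds$, $(\omega,t)\in\Omega\times[0,\infty)$, where $a$ is a progressive and pathwise locally integrable process.
   Context: $(\Omega,\mathcal{F})$ is a measurable space and $(\mathcal{F}_t)_{t\in[0,\infty)}$ is a filtration, i.e. an increasing family of sub-sigma-algebras of $\mathcal{F}$. No probability measure is involved, and no completeness or right-continuity of the filtration is assumed. $\mathcal{B}(\cdot)$ denotes Borel sigma-algebras, and integrals $ds$ are with respect to Lebesgue measure. A (real-valued) process is a mapping $X:\Omega\times[0,\infty)\to\mathbb{R}$ such that for every $t\in[0,\infty)$ the map $X(t):\omega\mapsto X(\omega,t)$ is measurable with respect to $\mathcal{F}$ and $\mathcal{B}(\mathbb{R})$. It is adapted if for every $t\in[0,\infty)$ the map $X(t)$ is measurable with respect to $\mathcal{F}_t$. The paths of $X$ are the functions $t\mapsto X(\omega,t)$, $\omega\in\Omega$. A process is continuous if all its paths are continuous. A process is progressive if, for every $t\in[0,\infty)$, its restriction to $\Omega\times[0,t]$ is measurable with respect to $\mathcal{F}_t\otimes\mathcal{B}([0,t])$. The predictable sigma-algebra $\mathcal{P}$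 is the sigma-algebra on $\Omega\times[0,\infty)$ generated by all adapted and continuous processes. A process is predictable if it is measurable with respect to $\mathcal{P}$ (and $\mathcal{B}(\mathbb{R})$). A function $f:[0,\infty)\to\mathbb{R}$ is locally integrable if it is measurable with respect to $\mathcal{B}([0,\infty))$ and $\mathcal{B}(\mathbb{R})$ and $\int_0^t|f|\,ds<\infty$ for all $t\in[0,\infty)$. A process is pathwise locally integrable if every one of its paths is locally integrable. A function $G:[0,\infty)\to\mathbb{R}$ is absolutely continuous if there exists a locally integrable function $f:[0,\infty)\to\mathbb{R}$ such that $G(t)=\int_0^t f\,ds$ for all $t\in[0,\infty)$ (so in particular $G(0)=0$). A process is absolutely continuous if every one of its paths is absolutely continuous in this sense; no joint measurability of the densities in $(\omega,t)$ is assumed. *)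

(* Defs.v *)
From HB Require Import structures.
From mathcomp Require Import all_boot all_order all_algebra.
From mathcomp Require Import all_classical all_reals all_analysis.

Set Implicit Arguments.
Unset Strict Implicit.
Unset Printing Implicit Defensive.

Import Order.TTheory GRing.Theory Num.Theory.
Import numFieldNormedType.Exports.

Local Open Scope classical_set_scope.
Local Open Scope ring_scope.

(* Sigma-algebras are set systems satisfying [sigma_algebra] rather than
   [measurableType] instances: a filtration puts many of them on one carrier,
   and [measurableType] would require that carrier to be nonempty. *)

(* As a [set_type], this carries the topology induced by R. *)
Notation time R := (set_type [set` `[0%R : R, +oo[]).

Section sigma_algebras.
Context {R : realType}.

(* The restriction of [f] to [D] is measurable from (D, G) to (R, B(R)), where
   [G] is a sigma-algebra on [D]. *)
Definition measurable_wrt {T : Type} (D : set T) (G : set (set T))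
    (f : T -> R) : Prop :=
  preimage_set_system D f (@measurable _ R) `<=` G.

(* B(K), as a sigma-algebra on the subset [K] rather than on a subtype. *)
Definition borel_on (K : set (time R)) : set (set (time R)) :=
  <<s K, [set K `&` U | U in open] >>.

Definition prod_sigma_algebra {T1 T2 : Type} (D1 : set T1) (D2 : set T2)
    (G1 : set (set T1)) (G2 : set (set T2)) : set (set (T1 * T2)) :=
  <<s D1 `*` D2, [set A `*` B | A in G1 & B in G2] >>.

End sigma_algebras.

Section functions_on_the_half_line.
Context {R : realType}.
Implicit Types (f G : time R -> R) (t : time R).

Local Notation mu := (@lebesgue_measure R).

(* The integrands below are extended to R by 0 (['valL_0]) so that they can be
   integrated against Lebesgue measure; the extension is never evaluated
   outside [0, +oo). *)

Definition integral_to f t : R :=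
  \int[mu]_(s in `[0, set_val t]) 'valL_(0) f s.

Definition loc_integrable f : Prop :=
  measurable_wrt setT (borel_on setT) f /\
  forall t, (\int[mu]_(s in `[0%R, set_val t]) `|'valL_(0%R) f s|%:E < +oo)%E.

(* [G] is a primitive starting at 0, so in particular it vanishes there. *)
Definition abs_continuous G : Prop :=
  exists2 f, loc_integrable f & forall t, G t = integral_to f t.

End functions_on_the_half_line.

Section processes.
Context {R : realType} {Omega : Type}.
Variables (F : set (set Omega)) (Ft : time R -> set (set Omega)).
Implicit Types X a : Omega * time R -> R.

Definition filtration : Prop :=
  [/\ forall t, sigma_algebra setT (Ft t),
      forall t, Ft t `<=` F &
      forall s t, set_val s <= set_val t -> Ft s `<=` Ft t].

Definition sample_path X (w : Omega) : time R -> R := fun t => X (w, t).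

Definition process X : Prop :=
  forall t, measurable_wrt setT F (fun w => X (w, t)).

Definition adapted X : Prop :=
  forall t, measurable_wrt setT (Ft t) (fun w => X (w, t)).

Definition continuous_paths X : Prop := forall w, continuous (sample_path X w).

Definition progressive X : Prop :=
  forall t, let I := [set s : time R | set_val s <= set_val t] in
    measurable_wrt (setT `*` I)
      (prod_sigma_algebra setT I (Ft t) (borel_on I)) X.

Definition predictable_sigma_algebra : set (set (Omega * time R)) :=
  <<s \bigcup_(Y in [set Y | [/\ process Y, adapted Y & continuous_paths Y]])
        preimage_set_system setT Y (@measurable _ R) >>.

Definition predictable X : Prop :=
  measurable_wrt setT predictable_sigma_algebra X.

Definition pathwise_loc_integrable X : Prop :=
  forall w, loc_integrable (sample_path X w).

Definition abs_continuous_paths X : Prop :=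
  forall w, abs_continuous (sample_path X w).

Definition time_integral a : Omega * time R -> R :=
  fun wt => integral_to (sample_path a wt.1) wt.2.

End processes.

(* Main.v *)
Require Import Defs.
From HB Require Import structures.
From mathcomp Require Import all_boot all_order all_algebra.
From mathcomp Require Import all_classical all_reals all_analysis.
From mathcomp Require Import measurable_realfun.

Set Implicit Arguments.
Unset Strict Implicit.
Unset Printing Implicit Defensive.

Import Order.TTheory GRing.Theory Num.Theory.
Import numFieldNormedType.Exports.

Local Open Scope classical_set_scope.
Local Open Scope ring_scope.

(** Two of the three inclusions are measure theory; the remaining one is
Lebesgue's differentiation theorem.

A predictable process is progressive ([predictable_progressive]): it is enough
to check the generators of the predictable sigma-algebra, and an adapted
process Y with continuous paths, stopped at t, is a Caratheodory function of
(w, x), measurable in w for F_t and continuous in x, hence jointly measurable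
([measurable_caratheodory]).

The time integral of a progressive process is adapted
([progressive_integral_adapted]): Tonelli's theorem makes the integral over
[0, t] of the positive and of the negative part of a jointly measurable
function measurable in the remaining variable.

For an adapted process X with absolutely continuous paths, the density is
recovered from X by one formula that does not depend on the path, the upper
limit of the backward difference quotients n (X(w, t) - X(w, t - 1/n)), read as
0 where it is infinite ([density]).  Looking backward keeps each quotient
adapted, and each has continuous paths, so the upper limit is predictable
([predictable_density]).  On a single path, X is the primitive of some locally
integrable f, and by Lebesgue's differentiation theorem the quotients converge
to f(t) for almost every t ([ae_derivative_limsup]); so the upper limit is
locally integrable and has the same primitive as f
([loc_integrable_derivative_limsup], [integral_derivative_limsup]). *)

(** * Measurability with respect to a system of sets *)

(** The sets whose preimage is measurable form a sigma-algebra on [D2]: as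
[f] maps [D1] into [D2], relative complements in [D2] pull back to relative
complements in [D1]. *)
Lemma preimage_generated {T1 T2 : Type} (D1 : set T1) (D2 : set T2)
    (f : T1 -> T2) (G1 : set (set T1)) (G2 : set (set T2)) :
  sigma_algebra D1 G1 -> D1 `<=` f @^-1` D2 ->
  (forall B, G2 B -> G1 (D1 `&` f @^-1` B)) ->
  forall B, <<s D2, G2>> B -> G1 (D1 `&` f @^-1` B).
Proof.
move=> [G10 G1D G1U] fD fG2 B GB.
apply: (GB [set A | G1 (D1 `&` f @^-1` A)]); split; last exact: fG2.
split=> [|A /= /G1D GA|A GA] /=.
- by rewrite preimage_set0 setI0.
- rewrite (_ : _ `&` _ = D1 `\` (D1 `&` f @^-1` A))//.
  rewrite predeqE => x; split=> [[D1x [_ nA]]|[D1x nA]].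
    by split=> // -[].
  by split=> //; split; [exact: fD|move=> Ax; exact: nA].
- rewrite preimage_bigcup setI_bigcupr; exact: G1U.
Qed.

(** A carrier with a chosen point and a chosen sigma-algebra, as a measurable
type.  The sigma-algebra is an argument of the alias, so the same carrier can be
used with each member of a filtration. *)
Section sigma_alg_type.
Context {T : Type}.

Definition sigma_alg_type (x0 : T) (G : set (set T))
  (sG : sigma_algebra setT G) : Type := T.

Variables (x0 : T) (G : set (set T)) (sG : sigma_algebra setT G).
Local Notation gT := (sigma_alg_type x0 sG).

HB.instance Definition _ := gen_eqMixin gT.
HB.instance Definition _ := gen_choiceMixin gT.
HB.instance Definition _ := isPointed.Build gT x0.

Let gmeas0 : G set0. Proof. by have [] := sG. Qed.
Let gmeasC (A : set gT) : G A -> G (~` A).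
Proof. by have [_ GC _] := sG; move=> /GC; rewrite setTD. Qed.
Let gmeasU (A : (set gT)^nat) : (forall i, G (A i)) -> G (\bigcup_i A i).
Proof. by have [_ _] := sG; apply. Qed.

HB.instance Definition _ :=
  isMeasurable.Build default_measure_display gT gmeas0 gmeasC gmeasU.

Lemma measurable_wrtP {R : realType} (f : T -> R) :
  measurable_wrt setT G f <-> measurable_fun setT (f : gT -> R).
Proof.
split=> [mf _ B mB|mf _ [B mB <-]]; first by apply: mf; exists B.
exact: (mf measurableT).
Qed.

End sigma_alg_type.

(** An empty carrier has no base point to build [sigma_alg_type] from, so it is
treated apart. *)
Lemma measurable_wrt_empty {R : realType} (T : Type) (G : set (set T))
    (f : T -> R) : sigma_algebra setT G -> (T -> False) ->
  measurable_wrt setT G f.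
Proof.
case=> G0 _ _ T0 A _; suff -> : A = set0 by [].
by rewrite predeqE => x; case: (T0 x).
Qed.

(** The upper limit is taken in the extended reals, where it always exists;
[fine] then replaces its infinite values by 0. *)
Lemma measurable_wrt_limsup {R : realType} (T : Type) (G : set (set T))
    (h : nat -> T -> R) : sigma_algebra setT G ->
  (forall n, measurable_wrt setT G (h n)) ->
  measurable_wrt setT G (fun x => fine (limn_esup (fun n => (h n x)%:E))).
Proof.
move=> sG mh; have [[x0]|T0] := pselect (inhabited T); last first.
  exact: measurable_wrt_empty sG (fun x => T0 (inhabits x)).
apply/(measurable_wrtP x0 sG).
apply: (measurableT_comp (f := fine)); first exact: fine_measurable.
apply: (@measurable_fun_limn_esup _ (sigma_alg_type x0 sG) R setT
  (fun n x => (h n x)%:E)) => n.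
by apply/measurable_EFinP; exact/measurable_wrtP.
Qed.

Lemma measurable_wrt_scaled_diff {R : realType} (T : Type) (G : set (set T))
    (f g : T -> R) (c : R) : sigma_algebra setT G ->
  measurable_wrt setT G f -> measurable_wrt setT G g ->
  measurable_wrt setT G (fun x => c * (f x - g x)).
Proof.
move=> sG mf mg; have [[x0]|T0] := pselect (inhabited T); last first.
  exact: measurable_wrt_empty sG (fun x => T0 (inhabits x)).
apply/(measurable_wrtP x0 sG); apply: measurable_funM => //.
by apply: measurable_funB; exact/measurable_wrtP.
Qed.

(** * The half-line as a retract of the real line *)

Section time_axis.
Context {R : realType}.
Implicit Types (x s : R) (t : time R) (K : set (time R)).

Fact pos_subproof x : Num.max 0 x \in [set` `[0%R : R, +oo[].
Proof. by rewrite inE /= in_itv/= andbT le_max lexx. Qed.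

(** The retraction of the real line onto [0, +oo); it lets every function on
the half-line be studied as a function on the real line. *)
Definition pos x : time R := exist _ (Num.max 0 x) (pos_subproof x).

Lemma set_val_pos x : set_val (pos x) = Num.max 0 x.
Proof. by []. Qed.

Lemma time_ge0 t : 0 <= set_val t.
Proof. by have := set_mem (valP t); rewrite /= in_itv/= andbT. Qed.

Lemma set_valK : cancel (@set_val _ [set` `[0%R : R, +oo[]) pos.
Proof. by move=> t; apply: val_inj => /=; rewrite max_r// time_ge0. Qed.

Lemma continuous_set_val : continuous (set_val : time R -> R).
Proof. exact: initial_continuous. Qed.

Lemma continuous_pos : continuous pos.
Proof.
apply: continuous_comp_initial => x.
by apply: continuous_max; [exact: cvg_cst|exact: cvg_id].
Qed.

Lemma valL_pos (f : time R -> R) s : 0 <= s -> 'valL_(0) f s = f (pos s).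
Proof.
move=> s0; have sP : s \in [set` `[0%R : R, +oo[].
  by rewrite inE /= in_itv/= s0.
rewrite /valL_ oinv_set_val /= insubT /=; congr f.
by apply: val_inj; rewrite /= max_r.
Qed.

Lemma valL_neg (f : time R -> R) s : s < 0 -> 'valL_(0) f s = 0.
Proof.
move=> s0; rewrite /valL_ oinv_set_val /= insubN//.
by apply/negP; rewrite inE /= in_itv/= leNgt s0.
Qed.

Lemma borel_on_preimage K (f : R -> time R) (B : set (time R)) :
  continuous f -> (forall x, K (f x)) -> borel_on K B ->
  measurable (f @^-1` B).
Proof.
move=> cf Kf KB; rewrite -[_ @^-1` _]setTI.
apply: (preimage_generated _ _ _ KB) => [|x _|_ [U oU <-]].
- exact: sigma_algebra_measurable.
- exact: Kf.
rewrite setTI preimage_setI; apply: measurableI.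
  rewrite (_ : f @^-1` K = setT)//.
  by rewrite predeqE => x; split=> // _; exact: Kf.
by apply: open_measurable; move/continuousP : cf; exact.
Qed.

Lemma measurable_wrt_continuous K (f : time R -> R) :
  continuous f -> measurable_wrt K (borel_on K) f.
Proof.
move=> cf _ [B mB <-]; have {mB} : <<s @RGenOInfty.G R>> B.
  by have -> : <<s @RGenOInfty.G R>> = @measurable _ R
    by exact/esym/RGenOInfty.measurableE.
apply: preimage_generated => //; first exact: smallest_sigma_algebra.
move=> _ [x ->]; apply: sub_sigma_algebra; eexists; last reflexivity.
by move/continuousP : cf; apply; exact: rray_open.
Qed.

(** The retraction of the real line onto [0, t]. *)
Definition clamp t x : time R := pos (Num.min (set_val t) x).

Lemma set_val_clamp t x :
  set_val (clamp t x) = Num.max 0 (Num.min (set_val t) x).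
Proof. by []. Qed.

Lemma clamp_le t x : set_val (clamp t x) <= set_val t.
Proof. by rewrite set_val_clamp ge_max time_ge0 ge_min lexx. Qed.

Lemma clampE t x : x <= set_val t -> clamp t x = pos x.
Proof. by move=> xt; rewrite /clamp min_r. Qed.

Lemma clamp_set_val t (u : time R) : set_val u <= set_val t ->
  clamp t (set_val u) = u.
Proof. by move=> ut; rewrite clampE// set_valK. Qed.

Lemma continuous_clamp t : continuous (clamp t).
Proof.
move=> x; apply: continuous_comp; last exact: continuous_pos.
by apply: continuous_min; [exact: cvg_cst|exact: cvg_id].
Qed.

End time_axis.

(** * Joint measurability and integrals depending on a parameter *)

Section joint_measurability.
Context {R : realType}.
Local Notation mu := (@lebesgue_measure R).

(** Rounding the second variable down to a multiple of 1/(n+1) gives functions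
whose preimages are countable unions of measurable rectangles, and they converge
pointwise by continuity in the second variable. *)
Lemma measurable_caratheodory d (T : measurableType d) (g : T * R -> R) :
  (forall x, measurable_fun setT (fun w => g (w, x))) ->
  (forall w, continuous (fun x => g (w, x))) ->
  measurable_fun setT g.
Proof.
move=> mg cg.
pose q n (x : R) : R := (Num.floor (x * n.+1%:R))%:~R / n.+1%:R.
apply: (@measurable_fun_cvg _ _ _ _ (fun n z => g (z.1, q n z.2))) => [n|z _].
  move=> _ B mB; rewrite setTI.
  rewrite (_ : _ @^-1` B = \bigcup_(m : int)
      ([set w | B (g (w, m%:~R / n.+1%:R))] `*`
       [set x | Num.floor (x * n.+1%:R) = m])); last first.
    apply/seteqP; split=> [[w x] /= Bg|[w x] [m _ [/= Bg xm]]].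
      by exists (Num.floor (x * n.+1%:R)).
    by rewrite /q xm.
  apply: countable_bigcupT_measurable => // m.
  apply: measurableX.
    by rewrite -[X in measurable X]setTI; exact: mg.
  rewrite (_ : mkset _ = (fun x : R => x * n.+1%:R) @^-1`
      `[m%:~R, (m + 1)%:~R[%classic); last first.
    apply/seteqP; split=> x /=; by rewrite in_itv /= -floor_eq => /eqP.
  rewrite -[X in measurable X]setTI.
  by apply: mulrr_measurable => //; exact: measurable_itv.
have qz : q n z.2 @[n --> \oo] --> z.2.
  apply: (@squeeze_cvgr _ _ _ _ (fun n => z.2 - n.+1%:R^-1) (cst z.2)).
  - apply: nearW => n /=; have n0 : 0 < n.+1%:R :> R by rewrite ltr0n.
    rewrite /q ler_pdivrMr// floor_le andbT lerBlDr.
    rewrite -[X in _ + X]mul1r -mulrDl ler_pdivlMr//.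
    by have /ltW := floorD1_gt (z.2 * n.+1%:R); rewrite intrD.
  - rewrite -[X in _ --> X]subr0; apply: cvgB; first exact: cvg_cst.
    exact: cvg_harmonic.
  - exact: cvg_cst.
have := @cvg_comp _ _ _ _ _ _ _ _ qz (cg z.1 z.2).
by case: z {qz}.
Qed.

(** Tonelli's theorem applies to the integrals of the positive and of the
negative part, whose difference is the integral by definition. *)
Lemma measurable_Rintegral_param d (T : measurableType d) (g : T * R -> R)
    (D : set R) : measurable D -> measurable_fun setT g ->
  measurable_fun setT (fun w => \int[mu]_(s in D) g (w, s)).
Proof.
move=> mD mg.
have tonelli (h : T * R -> \bar R) : measurable_fun setT h ->
    (forall z, 0 <= h z)%E ->
    measurable_fun setT (fun w => \int[mu]_(s in D) h (w, s))%E.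
  move=> mh h0.
  have := @measurable_fun_fubini_tonelli_F _ _ T (measurableTypeR R) R mu
    (h \_ (setT `*` D)).
  rewrite /fubini_F => H.
  rewrite (_ : (fun w => _) =
      fun w => (\int[mu]_s (h \_ (setT `*` D)) (w, s))%E); last first.
    apply/funext => w; rewrite integral_mkcond; apply: eq_integral => s _.
    by rewrite !patchE in_setX in_setT.
  apply: H.
    apply/(measurable_restrictT _ _).1; first exact: measurableX.
    exact: measurable_funTS.
  by move=> z; rewrite patchE; case: ifP.
apply: (measurableT_comp (f := fine)); first exact: fine_measurable.
rewrite (_ : (fun w => _) = fun w =>
    (\int[mu]_(s in D) ((EFin \o g)^\+ (w, s)) -
     \int[mu]_(s in D) ((EFin \o g)^\- (w, s)))%E); last first.
  apply/funext => w; rewrite integralE.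
  by congr (_ - _)%E; apply: eq_integral => s _; rewrite ?funeposE ?funenegE.
apply: emeasurable_funB; apply: tonelli => //.
  by apply: measurable_funepos; exact/measurable_EFinP.
by apply: measurable_funeneg; exact/measurable_EFinP.
Qed.

End joint_measurability.

(** * Progressive, predictable and adapted processes *)

Section progressive.
Context {R : realType} {Omega : Type}.
Variables (w0 : Omega) (G : set (set Omega)) (sG : sigma_algebra setT G).
Variable t : time R.
Local Notation I := [set s : time R | set_val s <= set_val t].
Local Notation gOmega := (sigma_alg_type w0 sG).

(** Transfers progressive measurability at time [t] from the subset
Omega x [0, t], where products are taken relative to a subset, to the product
space Omega x R, where Tonelli's theorem applies; the clamp and the
inclusion of [0, t] in R are measurable in the two directions. *)
Lemma measurable_wrt_clampP (X : Omega * time R -> R) :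
  measurable_wrt (setT `*` I) (prod_sigma_algebra setT I G (borel_on I)) X <->
  measurable_fun setT (fun z : gOmega * R => X (z.1, clamp t z.2)).
Proof.
split=> [mX _ B mB|mX _ [B mB <-]].
  pose Phi (z : gOmega * R) : Omega * time R := (z.1, clamp t z.2).
  have mXB : prod_sigma_algebra setT I G (borel_on I)
    ((setT `*` I) `&` X @^-1` B) by apply: mX; exists B.
  rewrite (_ : _ @^-1` B = Phi @^-1` ((setT `*` I) `&` X @^-1` B)); last first.
    apply/seteqP; split=> z /= => [Bz|[]//].
    by split=> //; split=> //; exact: clamp_le.
  apply: (preimage_generated _ _ _ mXB).
  - exact: sigma_algebra_measurable.
  - by move=> z _; split=> //; exact: clamp_le.
  - move=> _ [A GA [C mC <-]]; rewrite setTI.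
    rewrite (_ : Phi @^-1` _ = A `*` (clamp t @^-1` C))//.
    apply: measurableX => //.
    apply: (@borel_on_preimage _ I) => //; first exact: continuous_clamp.
    exact: clamp_le.
pose Psi (z : Omega * time R) : gOmega * R := (z.1, set_val z.2).
pose Xc (z : gOmega * R) : R := X (z.1, clamp t z.2).
have : measurable (Xc @^-1` B) by rewrite -[_ @^-1` _]setTI; exact: mX.
rewrite measurable_prod_measurableType => mXc.
rewrite (_ : _ `&` X @^-1` B = (setT `*` I) `&` Psi @^-1` (Xc @^-1` B)).
  apply: (preimage_generated _ _ _ mXc) => //.
    exact: smallest_sigma_algebra.
  move=> _ [A GA [C mC <-]]; apply: sub_sigma_algebra.
  exists A => //; exists (I `&` set_val @^-1` C).
    apply: measurable_wrt_continuous; last by exists C.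
    exact: continuous_set_val.
  by apply/seteqP; split=> [[w s] [/= ? []]|[w s] [[_ ?] [/= ? ?]]].
by apply/seteqP; split=> [[w s] [[_ /= st] Bs]|[w s] [[_ /= st] Bs]];
  split=> //; move: Bs; rewrite /Psi /Xc /= clamp_set_val.
Qed.

End progressive.

Section measurability_of_processes.
Context {R : realType} {Omega : Type}.
Variables (F : set (set Omega)) (Ft : time R -> set (set Omega)).
Hypothesis Ft_filtration : filtration F Ft.

(** On Omega x [0, t] a generator Y agrees with (w, x) |-> Y(w, clamp t x), and
this only reads Y at times up to t: it is therefore measurable in w for F_t. *)
Lemma predictable_progressive (a : Omega * time R -> R) :
  predictable F Ft a -> progressive Ft a.
Proof.
have [sFt _ Ft_le] := Ft_filtration.
move=> pa t /=; set I := [set s : time R | _].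
have [[w0]|O0] := pselect (inhabited Omega); last first.
  move=> _ [B _ <-]; rewrite (_ : _ `&` _ = set0); first exact: sigma_algebra0.
  by rewrite predeqE => -[w s]; case: (O0 (inhabits w)).
move=> _ [B mB <-]; have aB : predictable_sigma_algebra F Ft (a @^-1` B).
  by apply: pa; exists B; rewrite ?setTI.
apply: (preimage_generated (f := id) _ _ _ aB) => [|//|].
  exact: smallest_sigma_algebra.
move=> _ [Y [_ adY cY] [C mC <-]]; rewrite setTI.
suff : measurable_wrt (setT `*` I) (prod_sigma_algebra setT I (Ft t)
  (borel_on I)) Y by apply; exists C.
apply/(measurable_wrt_clampP w0 (sFt t)).
apply: measurable_caratheodory => [x|w x] /=.
  apply/measurable_wrtP => _ [D mD <-]; apply: (Ft_le (clamp t x)).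
    exact: clamp_le.
  by apply: adY; exists D.
apply: (@continuous_comp _ _ _ (clamp t) (sample_path Y w)).
  exact: continuous_clamp.
exact: cY.
Qed.

Lemma progressive_integral_adapted (a : Omega * time R -> R) :
  progressive Ft a -> adapted Ft (time_integral a).
Proof.
have [sFt _ _] := Ft_filtration.
move=> pa t; have [[w0]|O0] := pselect (inhabited Omega); last first.
  exact: measurable_wrt_empty (sFt t) (fun w => O0 (inhabits w)).
apply/(measurable_wrtP w0 (sFt t)).
have /(measurable_wrt_clampP w0 (sFt t)) ma := pa t.
have := measurable_Rintegral_param (D := `[0, set_val t]%classic)
  (measurable_itv _) ma.
congr measurable_fun; apply/funext => w; apply: eq_Rintegral => s.
rewrite inE /= in_itv /= => /andP[s0 st].
by rewrite clampE//; exact/esym/valL_pos.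
Qed.

End measurability_of_processes.

(** * Primitives of locally integrable functions *)

Section absolutely_continuous_functions.
Context {R : realType}.
Local Notation mu := (@lebesgue_measure R).
Implicit Types f G : time R -> R.

Lemma measurable_valL f : measurable_wrt setT (borel_on setT) f ->
  measurable_fun setT ('valL_(0) f : R -> R).
Proof.
move=> mf; rewrite (_ : 'valL_(0) f = (f \o pos) \_ `[0, +oo[%classic).
  apply/(measurable_restrictT _ _).1; first exact: measurable_itv.
  apply: measurable_funTS => _ B mB; rewrite setTI comp_preimage.
  apply: (@borel_on_preimage _ setT) => //; first exact: continuous_pos.
  by apply: mf; exists B; rewrite ?setTI.
apply/funext => s; rewrite patchE mem_setE in_itv /= andbT.
by case: ltP => s0; [exact: valL_neg|exact: valL_pos].
Qed.

(** The extension by 0 vanishes on the negative half-line, so its integral over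
[D] only sees the bounded set of nonnegative points of [D]. *)
Lemma integrable_valL f (D : set R) (T : R) : loc_integrable f ->
  measurable D -> D `<=` `]-oo, T] -> mu.-integrable D (EFin \o 'valL_(0) f).
Proof.
move=> [mf lf] mD DT; have mvf := measurable_valL mf.
pose T' : time R := pos T.
have fT' : mu.-integrable `[0, set_val T'] (EFin \o 'valL_(0) f).
  apply/integrableP; split.
    by apply/measurable_EFinP; exact: measurable_funTS.
  by have := lf T'; congr (_ < _)%E; apply: eq_integral.
have mI : measurable `[0, set_val T']%classic by exact: measurable_itv.
have := (@integrable_mkcond _ (measurableTypeR R) R mu _
  (EFin \o 'valL_(0) f) mI).1 fT'.
move=> /(@integrableS _ (measurableTypeR R) R mu _ _ _ measurableT mD
  (@subsetT _ _)).
apply: (@eq_integrable _ (measurableTypeR R) R mu _ mD) => s.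
rewrite inE => /DT /=; rewrite in_itv /= => sT.
rewrite patchE mem_setE in_itv /= le_max sT orbT andbT; case: leP => // s0.
by congr EFin; exact/esym/valL_neg.
Qed.

End absolutely_continuous_functions.

(** * Recovering a density from its primitive *)

Section difference_quotients.
Context {R : realType}.
Local Notation mu := (@lebesgue_measure R).

(** Stopped at 0; a primitive extended by 0 to negative times has the same value
at the stopped time. *)
Definition lag n (t : time R) : time R := pos (set_val t - n.+1%:R^-1).

Definition diff_quot n (G : time R -> R) t : R := n.+1%:R * (G t - G (lag n t)).

Definition derivative_limsup (G : time R -> R) t : R :=
  fine (limn_esup (fun n => (diff_quot n G t)%:E)).

Lemma lag_le n t : set_val (lag n t) <= set_val t.
Proof.
by rewrite set_val_pos ge_max time_ge0/= lerBlDr lerDl invr_ge0 ler0n.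
Qed.

Lemma continuous_lag n : continuous (lag n).
Proof.
move=> t; apply: (@continuous_comp _ _ _ (fun s : time R =>
  set_val s - n.+1%:R^-1) pos); last exact: continuous_pos.
by apply: continuousB; [exact: continuous_set_val|exact: cst_continuous].
Qed.

Lemma continuous_diff_quot n (G : time R -> R) :
  continuous G -> continuous (diff_quot n G).
Proof.
move=> cG t; apply: (@continuousM _ _ (cst n.+1%:R)
  (fun s => G s - G (lag n s))).
  exact: cst_continuous.
apply: (@continuousB _ _ _ G (G \o lag n)); first exact: cG.
by apply: continuous_comp; [exact: continuous_lag|exact: cG].
Qed.

Lemma cvg_backward_quotient (F : R -> R) x : derivable F x 1 ->
  n.+1%:R * (F x - F (x - n.+1%:R^-1)) @[n --> \oo] --> 'D_1 F x.
Proof.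
move=> dF; pose u n : R := - n.+1%:R^-1.
have u0 : u n @[n --> \oo] --> (0 : R).
  by rewrite -oppr0; apply: cvgN; exact: cvg_harmonic.
have u0' : u n @[n --> \oo] --> (0 : R)^'.
  move=> A A0; have u0A : \forall n \near \oo, u n != 0 -> A (u n) := u0 _ A0.
  case: u0A => N _ uA; exists N => // n /uA; apply.
  by rewrite oppr_eq0 invr_eq0 pnatr_eq0.
pose q h : R := h^-1 *: (F (h *: 1 + x) - F x).
have dq : q h @[h --> (0 : R)^'] --> 'D_1 F x := dF.
suff -> : (fun n => n.+1%:R * (F x - F (x - n.+1%:R^-1))) = q \o u.
  exact: cvg_comp u0' dq.
apply/funext => n /=.
rewrite /q /u invrN invrK scaleNr -scalerN opprB /GRing.scale /= mulr1.
by rewrite (addrC _ x).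
Qed.

Section primitive.
Variable f : time R -> R.
Hypothesis lf : loc_integrable f.
Let fR : R -> R := 'valL_(0) f.
Let F x := \int[mu]_(s in `[0, x]) fR s.

(** At a negative [x] both sides vanish; hence [integral_to f] and [F] may be
exchanged in a backward quotient that reaches below 0. *)
Lemma primitive_pos x : integral_to f (pos x) = F x.
Proof.
rewrite /integral_to /F set_val_pos; case: (leP 0 x) => // x0.
rewrite set_itv1 Rintegral_set1 set_itv_ge ?Rintegral_set0//.
by rewrite bnd_simp -ltNge.
Qed.

(** For [c < 0] the same function becomes a primitive on an interval that has 0
in its interior, which removes the boundary point 0 from the continuity and
differentiation arguments. *)
Let primitive_left c : c <= 0 -> (fun x => \int[mu]_(s in `[c, x]) fR s) = F.
Proof.
move=> c0; apply/funext => x; rewrite /F /Rintegral.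
congr fine; rewrite integral_mkcond [RHS]integral_mkcond.
apply: eq_integral => s _; rewrite !patchE !mem_setE !in_itv /=.
case: (leP 0 s) => [s0|s0] /=; first by rewrite (le_trans c0 s0).
by case: ifP => // _; congr EFin; exact: valL_neg.
Qed.

Lemma primitive_continuous : continuous (integral_to f).
Proof.
have cF : continuous F.
  move=> x; pose b := `|x| + 1.
  have b0 : 0 < b by rewrite ltr_pwDr.
  have lb : - b <= b by rewrite (le_trans _ (ltW b0))// oppr_le0 ltW.
  have ltb : - b < b by rewrite (lt_trans _ b0)// oppr_lt0.
  have ifR : mu.-integrable `[- b, b] (EFin \o fR).
    apply: (@integrable_valL _ _ _ b lf) => //.
    by move=> s /=; rewrite !in_itv /= => /andP[].
  have := parameterized_integral_continuous lb ifR.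
  rewrite /parameterized_integral primitive_left; last by rewrite oppr_le0 ltW.
  move/(continuous_within_itvP _ ltb) => [+ _ _]; apply.
  rewrite in_itv /= -ltr_norml ltrDl//.
have -> : integral_to f = F \o set_val.
  by apply/funext => t; rewrite -[in LHS](set_valK t) primitive_pos.
by move=> t; apply: continuous_comp; [exact: continuous_set_val|exact: cF].
Qed.

(** Lebesgue's differentiation theorem: at almost every time [F] has derivative
[fR], and the backward quotients are a sequential case of that limit. *)
Lemma ae_derivative_limsup :
  {ae mu, forall x, 0 <= x -> derivative_limsup (integral_to f) (pos x) = fR x}.
Proof.
have locf : locally_integrable setT fR.
  split; [|exact: openT|].
    by apply: measurable_valL; case: lf.
  move=> K _ cK; have [M [Mr KM]] := compact_bounded cK.
  (* [M] bounds K only in the sense that every larger number does. *)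
  have KM1 : K `<=` `]-oo, M + 1].
    move=> s Ks /=; rewrite in_itv /= (le_trans (ler_norm _))//.
    by apply: KM Ks; rewrite ltrDl.
  have mK : measurable K.
    by apply: closed_measurable; apply: compact_closed => //; exact: Rhausdorff.
  by have /integrableP[] := integrable_valL lf mK KM1.
(* The derivative is obtained strictly to the right of the lower bound of
   integration: -1 rather than 0 makes this cover every x >= 0. *)
have := @FTC1 R fR (BLeft (-1)) _ locf.
have intf y :
    mu.-integrable [set` Interval (BLeft (-1)) (BRight y)] (EFin \o fR).
  apply: (@integrable_valL _ _ _ y lf) => //.
  by move=> s /=; rewrite !in_itv /= => /andP[].
move=> /(_ intf); apply: filterS => [|x + x0].
  exact: (ae_filter_ringOfSetsType mu).
rewrite lte_fin (lt_le_trans _ x0)// => /(_ isT)[].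
rewrite primitive_left ?oppr_le0// => dF; rewrite derive1E => F'E.
rewrite /derivative_limsup.
have cq : (diff_quot n (integral_to f) (pos x))%:E @[n --> \oo] --> (fR x)%:E.
  apply: cvg_EFin; first exact: nearW.
  rewrite -F'E; apply: cvg_trans (cvg_backward_quotient dF).
  apply: near_eq_cvg; apply: nearW => n /=.
  by rewrite /diff_quot /lag set_val_pos max_r// !primitive_pos.
by rewrite (cvg_limn_einf_sup cq).2.
Qed.

Lemma measurable_derivative_limsup :
  measurable_wrt setT (borel_on setT) (derivative_limsup (integral_to f)).
Proof.
apply: measurable_wrt_limsup => [|n]; first exact: smallest_sigma_algebra.
apply: measurable_wrt_continuous; apply: continuous_diff_quot.
exact: primitive_continuous.
Qed.

Let mfR : measurable_fun setT fR.
Proof. by apply: measurable_valL; case: lf. Qed.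

Let aR : R -> R := 'valL_(0) (derivative_limsup (integral_to f)).

Let maR : measurable_fun setT aR.
Proof. exact: measurable_valL measurable_derivative_limsup. Qed.

Let ae_aR (t : time R) :
  {ae mu, forall s, `[0, set_val t]%classic s -> aR s = fR s}.
Proof.
have := ae_derivative_limsup; apply: filterS => [|s + /=].
  exact: (ae_filter_ringOfSetsType mu).
rewrite in_itv /= => + /andP[s0 _]; move=> /(_ s0) <-.
exact: valL_pos.
Qed.

Lemma loc_integrable_derivative_limsup :
  loc_integrable (derivative_limsup (integral_to f)).
Proof.
split; first exact: measurable_derivative_limsup.
move=> t; have := lf.2 t; congr (_ < _)%E.
apply: (@ge0_ae_eq_integral _ (measurableTypeR R) R mu) => //.
- by apply/measurable_EFinP; apply: measurable_funTS; exact: measurableT_comp.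
- by apply/measurable_EFinP; apply: measurable_funTS; exact: measurableT_comp.
have := ae_aR t; apply: filterS => [|s + st].
  exact: (ae_filter_ringOfSetsType mu).
by move=> /(_ st); rewrite /aR /fR => ->.
Qed.

Lemma integral_derivative_limsup :
  integral_to (derivative_limsup (integral_to f)) = integral_to f.
Proof.
apply/funext => t; rewrite [LHS]/integral_to [RHS]/integral_to /Rintegral.
congr fine; apply: (@ae_eq_integral _ (measurableTypeR R) R mu) => //.
- by apply/measurable_EFinP; exact: measurable_funTS.
- by apply/measurable_EFinP; exact: measurable_funTS.
have := ae_aR t; apply: filterS => [|s + st].
  exact: (ae_filter_ringOfSetsType mu).
by move=> /(_ st); rewrite /aR /fR => ->.
Qed.

End primitive.
End difference_quotients.

(** * The density of an adapted process *)

Section density_process.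
Context {R : realType} {Omega : Type}.
Variables (F : set (set Omega)) (Ft : time R -> set (set Omega)).
Hypothesis Ft_filtration : filtration F Ft.
Implicit Types X : Omega * time R -> R.

Lemma adapted_process X : adapted Ft X -> process F X.
Proof.
by have [_ FtF _] := Ft_filtration; move=> aX t A /(aX t); exact: FtF.
Qed.

Definition diff_quot_process n X : Omega * time R -> R :=
  fun z => diff_quot n (sample_path X z.1) z.2.

(** One formula for every path; it is a density of [X] as soon as the paths of
[X] are absolutely continuous. *)
Definition density X : Omega * time R -> R :=
  fun z => derivative_limsup (sample_path X z.1) z.2.

Lemma adapted_diff_quot n X :
  adapted Ft X -> adapted Ft (diff_quot_process n X).
Proof.
have [sFt _ Ft_le] := Ft_filtration.
move=> aX t; apply: (measurable_wrt_scaled_diff (f := fun w => X (w, t))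
  (g := fun w => X (w, lag n t))); [exact: sFt|exact: aX|].
by move=> A /(aX (lag n t)); apply: Ft_le; exact: lag_le.
Qed.

Lemma process_density X : sigma_algebra setT F -> adapted Ft X ->
  process F (density X).
Proof.
move=> sF aX t.
apply: (measurable_wrt_limsup
  (h := fun n w => diff_quot_process n X (w, t))) => //.
by move=> n; apply: adapted_process; exact: adapted_diff_quot.
Qed.

(** The difference quotients are themselves generators of the predictable
sigma-algebra. *)
Lemma predictable_density X : adapted Ft X -> continuous_paths X ->
  predictable F Ft (density X).
Proof.
move=> aX cX; apply: (measurable_wrt_limsup (h := diff_quot_process ^~ X)).
  exact: smallest_sigma_algebra.
move=> n A hA; apply: sub_sigma_algebra; exists (diff_quot_process n X) => //.
split; last by move=> w; exact: continuous_diff_quot (cX w).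
  by apply: adapted_process; exact: adapted_diff_quot.
exact: adapted_diff_quot.
Qed.

End density_process.

Theorem mainTheorem2 (R : realType) (Omega : Type) (F : set (set Omega))
    (Ft : time R -> set (set Omega))
    (F_sigma : sigma_algebra [set: Omega] F) (Ft_filtration : filtration F Ft) :
  let S1 := [set X : Omega * time R -> R |
               [/\ process F X, adapted Ft X & abs_continuous_paths X]] in
  let S2 := [set time_integral a | a in
               [set a : Omega * time R -> R |
                 [/\ process F a, predictable F Ft a &
                     pathwise_loc_integrable a]]] in
  let S3 := [set time_integral a | a in
               [set a : Omega * time R -> R |
                 [/\ process F a, progressive Ft a &
                     pathwise_loc_integrable a]]] in
  S1 = S2 /\ S2 = S3.
Proof.
move=> S1 S2 S3.
have S12 : S1 `<=` S2.
  move=> X [_ aX acX].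
  have primX w : exists2 f, loc_integrable f & sample_path X w = integral_to f.
    by have [f lf Xf] := acX w; exists f => //; apply/funext.
  have cX : continuous_paths X.
    by move=> w; have [f lf ->] := primX w; exact: primitive_continuous.
  exists (density X).
    split=> [||w]; first exact: process_density Ft_filtration _ F_sigma aX.
      exact: predictable_density Ft_filtration _ aX cX.
    have [f lf Xf] := primX w.
    rewrite (_ : sample_path _ w = derivative_limsup (sample_path X w))//.
    by rewrite Xf; exact: loc_integrable_derivative_limsup.
  apply/funext => -[w t]; have [f lf Xf] := primX w.
  rewrite [LHS]/time_integral /=.
  rewrite (_ : sample_path _ w = derivative_limsup (sample_path X w))//.
  by rewrite Xf integral_derivative_limsup// -Xf.
have S23 : S2 `<=` S3.
  move=> _ [a [Pa pa la] <-]; exists a => //; split=> //.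
  exact: predictable_progressive Ft_filtration _ pa.
have S31 : S3 `<=` S1.
  move=> _ [a [_ pa la] <-].
  have aX := progressive_integral_adapted Ft_filtration pa.
  split=> //; first exact: adapted_process Ft_filtration _ aX.
  by move=> w; exists (sample_path a w).
split; apply/seteqP; split=> //.
  exact: subset_trans S23 S31.
exact: subset_trans S31 S12.
Qed.
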